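(* For every chord diagram $D$, $$W_J(D)=\mathrm{Per}(\mathrm{IM}_J(D)),$$ where $W_J$ is the $0$-framed colored Jones weight system (with values in $\mathbb{Q}[\lambda]$), $\mathrm{IM}_J(D)$ is the blown-up intersection matrix of $D$, and $\mathrm{Per}(A)$ denotes the permanent of a square matrix $A$.
   Context: **Chord diagrams.** A chord diagram $D$ with $n$ chords consists of $2n$ distinct points on an oriented line, paired into $n$ chords. Each chord has a left and a right end-point. The chords are ordered $1,\dots,n$ from left to right according to their left end-points. Two distinct chords with left/right end-points $a_1<a_2$ and $b_1<b_2$ intersect if $a_1<b_1<a_2<b_2$ or $b_1<a_1<b_2<a_2$; the first is completely contained in the second if $b_1<a_1<a_2<b_2$. **The weight system $W_J$.** $W_J$ is the $0$-framed colored Jones ($\mathfrak{sl}_2$) weight system, normalized to equal $1$ on the diagram with no chords. It is given explicitly as follows, with $\lambda$ an indeterminate. The end-points of the chords of $D$ cut the line into segments $s_0,\dots,s_{2n}$ listed from left to right. Given a map $\sigma:\{\text{chords of }D\}\to\{-1,0,1\}$, define integers $m(s_i)$ by $m(s_0)=0$, $m(s_{i+1})=m(s_i)+\sigma(v)$ if the point between $s_i$ and $s_{i+1}$ is the left end-point of the chord $v$, and $m(s_{i+1})=m(s_i)-\sigma(v)$ if it is the right end-point of $v$. For a chord $v$ let $k$ (resp. $k'$) be the value of $m$ on the segment ending at the left (resp. right) end-point of $v$, and set $$w_\sigma(v)=\begin{cases} (k+1)(\lambda-k'+1) & \sigma(v)=1 \\ (\lambda-k+1)(k'+1) & \sigma(v)=-1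 \\ \tfrac12\big((\lambda-2k)(\lambda-2k')-\lambda(\lambda+2)\big) & \sigma(v)=0. \end{cases}$$ Then $W_J(D)=\sum_\sigma\prod_v w_\sigma(v)$. **The matrix $\mathrm{IM}_J(D)$.** It is the $3n\times 3n$ matrix composed of $3\times 3$ blocks, with $(i,j)$ block ($1\le i,j\le n$) $$\mathrm{IM}_J(D)_{ij}=\begin{cases} A_{\mathrm{sign}(i-j)} & \text{if the distinct chords } i,j \text{ intersect} \\ A_0 & \text{if } i=j \\ A_c & \text{if } i,j\text{ do not intersect and } i \text{ is completely contained in } j \\ 0 & \text{otherwise,} \end{cases}$$ where $A_{\mathrm{sign}(i-j)}$ is $A_+$ if $i>j$ and $A_-$ if $i<j$, and $$A_0=\begin{pmatrix} \lambda+2 & 0 & 0 \\ 0 & \lambda+2 & 1 \\ \lambda & -\lambda-2 & 1 \end{pmatrix},\quad A_-=\begin{pmatrix} 0 & 0 & 0 \\ -1 & -1 & 0 \\ 0 & 0 & 0 \end{pmatrix},\quad A_+=\begin{pmatrix} 1 & 1 & 0 \\ 0 & 0 & 0 \\ 0 & 0 & 0 \end{pmatrix},\quad A_c=\begin{pmatrix} 1 & 1 & 0 \\ -1 & -1 & 0 \\ 0 & 0 & 0 \end{pmatrix}.$$ *)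

(* Defs.v *)
From mathcomp Require Import all_boot all_order all_fingroup all_algebra.

Set Implicit Arguments.
Unset Strict Implicit.
Unset Printing Implicit Defensive.

Import Order.TTheory GRing.Theory Num.Theory.
Local Open Scope ring_scope.

(* The line is 'I_(n.*2) with its natural order, and a chord is identified    *)
(* with its rank for the order of left end-points, so chords are numbered     *)
(* from 0.  Bijectivity of [end_point] says that every point is an end-point  *)
(* of exactly one chord.                                                      *)
Record chord_diagram (n : nat) := ChordDiagram {
  left_pt : 'I_n -> 'I_(n.*2);
  right_pt : 'I_n -> 'I_(n.*2);
  end_point := fun e : 'I_n + 'I_n =>
    match e with inl v => left_pt v | inr v => right_pt v end;
  end_point_bij : bijective end_point;
  left_lt_right : forall v, (left_pt v < right_pt v)%N;
  left_pt_mono : {homo left_pt : u v / (u < v)%N}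
}.

Section ChordRelations.
Variables (n : nat) (D : chord_diagram n).

Definition intersect (a b : 'I_n) : bool :=
  [&& left_pt D a < left_pt D b, left_pt D b < right_pt D a
    & right_pt D a < right_pt D b]%N ||
  [&& left_pt D b < left_pt D a, left_pt D a < right_pt D b
    & right_pt D b < right_pt D a]%N.

Definition contained_in (a b : 'I_n) : bool :=
  [&& left_pt D b < left_pt D a, left_pt D a < right_pt D a
    & right_pt D a < right_pt D b]%N.

End ChordRelations.

(* The set {-1, 0, 1} of integers, as a finite type. *)
Definition spin := seq_sub [:: -1; 0; 1 : int].

Section WeightSystem.
Variables (n : nat) (D : chord_diagram n).

Local Notation lambda := ('X : {poly rat}).

Section State.
Variable sigma : {ffun 'I_n -> spin}.

(* Each of the two sums has at most one term, and exactly one of them is      *)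
(* non-empty when p < 2n.                                                     *)
Definition jump (p : nat) : int :=
  \sum_(v | left_pt D v == p :> nat) val (sigma v) -
  \sum_(v | right_pt D v == p :> nat) val (sigma v).

(* [segval i] is the integer m(s_i); point p lies between s_p and s_(p+1),    *)
(* so the segment ending at point p is s_p.                                   *)
Fixpoint segval (i : nat) : int :=
  if i is p.+1 then segval p + jump p else 0.

Definition chord_weight (v : 'I_n) : {poly rat} :=
  let k := (segval (left_pt D v))%:~R in
  let k' := (segval (right_pt D v))%:~R in
  if val (sigma v) == 1 then (k + 1) * (lambda - k' + 1)
  else if val (sigma v) == -1 then (lambda - k + 1) * (k' + 1)
  else (1 / 2 : rat) *:
    ((lambda - 2 * k) * (lambda - 2 * k') - lambda * (lambda + 2)).

End State.

Definition WJ : {poly rat} :=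
  \sum_(sigma : {ffun 'I_n -> spin}) \prod_(v < n) chord_weight sigma v.

End WeightSystem.

Definition permanent (R : comNzRingType) (m : nat) (A : 'M[R]_m) : R :=
  \sum_(s : 'S_m) \prod_(i < m) A i (s i).

Definition mx3 (R : comNzRingType) (s : seq (seq R)) : 'M[R]_3 :=
  \matrix_(i < 3, j < 3) nth 0 (nth [::] s i) j.

Section IntersectionMatrix.

Local Notation lambda := ('X : {poly rat}).

Definition block0 : 'M[{poly rat}]_3 :=
  mx3 [:: [:: lambda + 2; 0; 0];
          [:: 0; lambda + 2; 1];
          [:: lambda; - lambda - 2; 1]].

Definition block_minus : 'M[{poly rat}]_3 :=
  mx3 [:: [:: 0; 0; 0];
          [:: -1; -1; 0];
          [:: 0; 0; 0]].

Definition block_plus : 'M[{poly rat}]_3 :=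
  mx3 [:: [:: 1; 1; 0];
          [:: 0; 0; 0];
          [:: 0; 0; 0]].

Definition block_c : 'M[{poly rat}]_3 :=
  mx3 [:: [:: 1; 1; 0];
          [:: -1; -1; 0];
          [:: 0; 0; 0]].

Definition IMJ_block n (D : chord_diagram n) (i j : 'I_n) : 'M[{poly rat}]_3 :=
  if (i != j) && intersect D i j then
    if (j < i)%N then block_plus else block_minus
  else if i == j then block0
  else if contained_in D i j then block_c
  else 0.

(* The index set of size 3n is presented as the sum of n copies of 3, which   *)
(* is the dimension [\mxblock] assigns to an n x n array of 3 x 3 blocks.     *)
Definition IMJ n (D : chord_diagram n) :
    'M[{poly rat}]_(\sum_(i < n) 3, \sum_(j < n) 3) :=
  \mxblock_(i < n, j < n) IMJ_block D i j.

End IntersectionMatrix.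

(* Main.v *)
From mathcomp Require Import all_boot all_order all_fingroup all_algebra.
From mathcomp Require Import zify ring.
Require Import Defs.

(* Glynn's formula writes a permanent as a weighted sum, over assignments t   *)
(* of values to the column variables, of the product of the linear forms      *)
(* given by the rows, each of which may be shifted by an arbitrary constant.  *)
(* For IM_J take two values for every variable: x1 in {0, 1}, x2 in {-1, 0},  *)
(* x3 in {0, 1}.  Off the diagonal the rows of chord i only see the sums      *)
(* sigma_j = x1 + x2 in {-1, 0, 1}, through k (first row) and k' - sigma_i    *)
(* (second row).  With the row shifts -lambda-1, -1 and 0, the sum over the   *)
(* values of chord i compatible with a given sigma_i is exactly the weight of *)
(* the chord i in the state sum of W_J.                                       *)

Set Implicit Arguments.
Unset Strict Implicit.
Unset Printing Implicit Defensive.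

Import GRing.Theory.
Local Open Scope ring_scope.

(** Glynn's formula ([permanent_glynn_block]) turns the permanent into a signed sum over assignments
    of values to the variables of all chords. Grouping the assignments by the spins sigma_j = x1 +
    x2 makes the outer sum the state sum. The geometric input is that m on a segment is the total
    spin of the chords lying over it ([segval_open]), while an off-diagonal block (i, j) only
    records which end-points of i lie under j ([IMJ_block_neq]). Hence the rows of chord i see the
    other chords through k and k' - sigma_i alone ([IMJ_block_row]). For fixed sigma the inner sum
    then factors over the chords, and [spin_weight_fiber] identifies each factor with the weight of
    the chord. *)

Lemma sum_option (R : nmodType) (I : finType) (F : option I -> R) :
  \sum_o F o = F None + \sum_i F (Some i).
Proof.
rewrite (bigD1 None) //=; congr (_ + _).
rewrite (reindex_omap Some id) => [|[i|]] //=.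
by apply: eq_bigl => i; rewrite eqxx.
Qed.

(** * Glynn's formula for permanents *)

Section Glynn.

Variables (R : comNzRingType) (m : nat) (T : finType) (c x : 'I_m -> T -> R).
Hypothesis c_sum0 : forall j, \sum_u c j u = 0.
Hypothesis c_mean1 : forall j, \sum_u c j u * x j u = 1.

Definition fiber (f : {ffun 'I_m -> option 'I_m}) (j : 'I_m) :=
  #|[pred i | f i == Some j]|.

(** The map [f] encodes one monomial of the expanded product of rows: row [i] picks the variable of
    a column, or its constant shift when [f i] is [None]. Then [fiber f j] is the degree in variable
    [j], and the sum factors because the variables take their values independently. *)
Lemma moment_fiber (f : {ffun 'I_m -> option 'I_m}) :
  \sum_(t : {ffun 'I_m -> T}) (\prod_j c j (t j)) *
     (\prod_i oapp (fun j => x j (t j)) 1 (f i)) =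
  \prod_(j < m) \sum_u c j u * x j u ^+ fiber f j.
Proof.
rewrite (bigA_distr_bigA (fun j u => c j u * x j u ^+ fiber f j)).
apply: eq_bigr => t _; rewrite big_split; congr (_ * _) => /=.
transitivity (\prod_i \prod_(j | f i == Some j) x j (t j)).
  apply: eq_bigr => i _; case: (f i) => [j|] /=; last by rewrite big_pred0.
  by rewrite (big_pred1 j) // => k; rewrite /= eq_sym.
rewrite (exchange_big_dep predT) //=.
by apply: eq_bigr => j _; rewrite prodr_const.
Qed.

(* The quadrature (c, x) annihilates constants and has first moment 1, so     *)
(* after expanding the product only the monomials containing every column     *)
(* variable survive, and there are m rows for m columns.                      *)
Lemma permanent_glynn (A : 'M[R]_m) (b : 'I_m -> R) :
  permanent A = \sum_(t : {ffun 'I_m -> T}) (\prod_j c j (t j)) *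
     \prod_i (b i + \sum_j A i j * x j (t j)).
Proof.
pose B i := oapp (A i) (b i).
transitivity (\sum_(f : {ffun 'I_m -> option 'I_m})
    (\prod_i B i (f i)) * \prod_j \sum_u c j u * x j u ^+ fiber f j);
    last first.
  under eq_bigr do rewrite -moment_fiber mulr_sumr.
  rewrite exchange_big; apply: eq_bigr => t _ /=.
  have sumE i : b i + \sum_j A i j * x j (t j) =
      \sum_o B i o * oapp (fun j => x j (t j)) 1 o.
    by rewrite sum_option /= mulr1.
  rewrite [in RHS](eq_bigr _ (fun i _ => sumE i)) bigA_distr_bigA mulr_sumr.
  by apply: eq_bigr => f _; rewrite big_split /= mulrCA.
(* The surviving monomials are those in which the rows pick each column exactly once. *)
pose some_perm (s : 'S_m) := [ffun i => Some (s i)].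
have some_perm_inj : injective some_perm.
  by move=> s s' /ffunP e; apply/permP => i; have := e i; rewrite !ffunE => -[].
have fiber_some_perm s j : fiber (some_perm s) j = 1%N.
  rewrite /fiber (@eq_card1 _ (s^-1 j)%g) // => i; rewrite !inE ffunE.
  by rewrite -(inj_eq (@perm_inj _ s)) permKV.
have fiber0 f : f \notin some_perm @: [set: 'S_m] -> exists j, fiber f j == 0%N.
  move=> nf; apply/existsP; apply: contraNT nf => /existsPn fib.
  (* If every column is picked, choosing one row per column is an injection of ['I_m] into itself,
     hence a permutation, and [f] is its inverse. *)
  have fP j : exists i, f i == Some j.
    by have := fib j; rewrite -lt0n => /card_gt0P[i]; exists i.
  pose g j := xchoose (fP j).
  have gK j : f (g j) = Some j by apply/eqP/(xchooseP (fP j)).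
  have g_inj : injective g by move=> j k e; apply: Some_inj; rewrite -!gK e.
  apply/imsetP; exists (perm g_inj)^-1%g => //; apply/ffunP => i; rewrite ffunE.
  by rewrite -{1}(permKV (perm g_inj) i) permE gK.
rewrite (bigID [in some_perm @: [set: 'S_m]]) /=.
rewrite [X in _ + X]big1 ?addr0; last first.
  move=> f /fiber0 [j /eqP fj]; rewrite [X in _ * X](bigD1 j) //= fj.
  rewrite (_ : \sum_u _ = 0) ?mul0r ?mulr0 // -[RHS](c_sum0 j).
  by apply: eq_bigr => u _; rewrite mulr1.
rewrite big_imset => [|s s' _ _ /some_perm_inj] //=.
apply: eq_big => s; rewrite ?inE // => _.
rewrite [X in _ * X]big1 ?mulr1; last first.
  by move=> j _; rewrite fiber_some_perm.
by apply: eq_bigr => i _; rewrite ffunE.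
Qed.

End Glynn.

(** Quadrature and shifts depend only on the position inside a block, so an assignment on the flat
    index set regroups as one [p]-tuple of values per block. *)
Lemma permanent_glynn_block (R : comNzRingType) (n p : nat) (T : finType)
    (c x : 'I_p -> T -> R) (B : 'I_n -> 'I_n -> 'M[R]_p) (b : 'I_p -> R) :
    (forall a, \sum_u c a u = 0) -> (forall a, \sum_u c a u * x a u = 1) ->
  permanent (\mxblock_(i < n, j < n) B i j) =
  \sum_(g : {ffun 'I_n -> {ffun 'I_p -> T}}) \prod_i
     ((\prod_a c a (g i a)) *
      \prod_a (b a + \sum_j \sum_a' B i j a a' * x a' (g j a'))).
Proof.
move=> c0 c1; pose col (i : 'I_(\sum_(i < n) p)) : 'I_p := tagnat.sig2 i.
have colK i (a : 'I_p) : col (@tagnat.Rank n (fun=> p) i a) = a.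
  by apply: val_inj; rewrite /col tagnat.Rank2K.
rewrite (@permanent_glynn _ _ _ (c \o col) (x \o col) _ _ _ (b \o col)) //=;
  try by move=> j; rewrite /= ?c0 ?c1.
pose flat (g : {ffun 'I_n -> {ffun 'I_p -> T}}) :
  {ffun 'I_(\sum_(i < n) p) -> T} := [ffun i => g (tagnat.sig1 i) (col i)].
pose unflat (t : {ffun 'I_(\sum_(i < n) p) -> T}) :
  {ffun 'I_n -> {ffun 'I_p -> T}} :=
  [ffun i => [ffun a => t (@tagnat.Rank n (fun=> p) i a)]].
have flatE g i a : flat g (@tagnat.Rank n (fun=> p) i a) = g i a.
  by rewrite ffunE colK tagnat.Rank1K.
have rank_bij : {on predT, bijective (@tagnat.rank n (fun=> p))}.
  exact: tagnat.rank_bij_on.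
have flatten (idx : R) (op : Monoid.com_law idx)
    (F : 'I_(\sum_(i < n) p) -> R) :
    \big[op/idx]_i F i =
    \big[op/idx]_i \big[op/idx]_a F (@tagnat.Rank n (fun=> p) i a).
  by rewrite sig_big_dep (reindex _ rank_bij); apply: eq_bigr => -[].
have flat_bij : bijective flat.
  exists unflat => [g|t].
    by apply/ffunP => i; apply/ffunP => a; rewrite 2!ffunE flatE.
  by apply/ffunP => i; rewrite !ffunE tagnat.sig2K.
rewrite (reindex flat) /=; last exact: onW_bij.
apply: eq_bigr => g _; rewrite big_split !flatten /=; congr (_ * _).
  by apply: eq_bigr => i _; apply: eq_bigr => a _; rewrite colK flatE.
apply: eq_bigr => i _; apply: eq_bigr => a _.
rewrite colK flatten; congr (_ + _).
apply: eq_bigr => j _; apply: eq_bigr => a' _.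
rewrite colK flatE; congr (_ * _).
by rewrite -[in RHS](mxblockK B i j) !mxE.
Qed.

(** * The local identity at one chord *)

Local Notation "'a0'" := (ord0 : 'I_3).
Local Notation "'a1'" := (lift ord0 ord0 : 'I_3).
Local Notation "'a2'" := (ord_max : 'I_3).
Local Notation lambda := ('X : {poly rat}).

Lemma sum3 (R : nmodType) (F : 'I_3 -> R) :
  \sum_a F a = F a0 + F a1 + F a2.
Proof.
by rewrite 3!big_ord_recl big_ord0 addr0 addrA; congr (_ + F _); apply: val_inj.
Qed.

Lemma sum_ffun3 (R : nmodType) (F : {ffun 'I_3 -> bool} -> R) :
  \sum_f F f =
  \sum_b \sum_b' \sum_b'' F [ffun a : 'I_3 => nth false [:: b; b'; b''] a].
Proof.
rewrite pair_bigA pair_bigA /=.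
rewrite (reindex (fun u : bool * bool * bool =>
  [ffun a : 'I_3 => nth false [:: u.1.1; u.1.2; u.2] a])) //.
exists (fun f : {ffun 'I_3 -> bool} => (f a0, f a1, f a2))
  => [[[b b'] b''] _|f _].
  by rewrite !ffunE.
apply/ffunP => a; rewrite ffunE /=.
by case: a => [[|[|[|a]]] pa] //=; congr (f _); apply: val_inj.
Qed.

Definition spin_of (b b' : bool) : spin :=
  if b && b' then @SeqSub _ [:: -1; 0; 1 : int] 1 isT
  else if b || b' then @SeqSub _ [:: -1; 0; 1 : int] 0 isT
  else @SeqSub _ [:: -1; 0; 1 : int] (-1) isT.

(** The two values differ by 1, so the weights 1 and -1 have total 0 and first moment 1. Lowering x2
    by 1 makes x1 + x2 range over {-1, 0, 1}. *)
Definition node (a : 'I_3) (b : bool) : {poly rat} := b%:R - (a == a1)%:R.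

Definition shift (a : 'I_3) : {poly rat} := nth 0 [:: - lambda - 1; -1; 0] a.

Lemma spin_ofE b b' : (val (spin_of b b'))%:~R = node a0 b + node a1 b'.
Proof. by case: b b' => [] []; rewrite /node /=; ring. Qed.

(* [r] is k' - s, the contribution to k' of the other chords. *)
Definition spin_weight (k r : {poly rat}) (s : int) : {poly rat} :=
  if s == 1 then (k + 1) * (lambda - (s%:~R + r) + 1)
  else if s == -1 then (lambda - k + 1) * (s%:~R + r + 1)
  else (1 / 2 : rat) *:
    ((lambda - 2 * k) * (lambda - 2 * (s%:~R + r)) - lambda * (lambda + 2)).

(** The signed sum over x3 of (u + x3)(v + x3) is u + v + 1. For the second and third rows this
    equals lambda x1 - r: x2 cancels and survives only in the sign. Spins 1 and -1 come from a
    single pair (x1, x2), spin 0 from two pairs. *)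
Lemma spin_weight_fiber (k r : {poly rat}) (s : spin) :
  spin_weight k r (val s) =
  \sum_(f : {ffun 'I_3 -> bool} | spin_of (f a0) (f a1) == s)
    (\prod_a (-1) ^+ (~~ f a)) *
    \prod_a (shift a +
       nth 0 [:: (lambda + 2) * node a0 (f a0) + k;
                 (lambda + 2) * node a1 (f a1) + node a2 (f a2) - r;
                 lambda * node a0 (f a0) - (lambda + 2) * node a1 (f a1) +
                   node a2 (f a2)] a).
Proof.
(* Used for spin 0, to put the scalar 1/2 in front of both sides so that a plain ring identity
   remains. *)
have scale2 (p : {poly rat}) : (1 / 2 : rat) *: (2 * p) = p.
  by rewrite mulr_natl -scaler_nat scalerA divrK ?scale1r.
rewrite big_mkcond sum_ffun3 !big_bool !big_ord_recl !big_ord0 !ffunE /=.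
rewrite -!(inj_eq val_inj) /spin_weight /shift /node /=.
case: s => s ps /=; move: (ps); rewrite !inE.
case/or3P => /eqP -> /=.
- ring.
- rewrite -[RHS]scale2; congr (_ *: _); ring.
- ring.
Qed.

(** * Segment values and matrix rows in terms of open chords *)

Section Chords.
Variables (n : nat) (D : chord_diagram n).

Definition open_at (p : nat) (j : 'I_n) : bool :=
  (left_pt D j < p < right_pt D j)%N.

(** A chord adds its spin at its left end-point and takes it back at its right one. The right
    inequality is weak because s_p ends at point p: a chord ending there still counts, which is why
    k' contains the spin of its own chord and k does not. *)
Lemma segval_open (sigma : {ffun 'I_n -> spin}) (p : nat) :
  segval D sigma p =
  \sum_(j | (left_pt D j < p <= right_pt D j)%N) val (sigma j).
Proof.
transitivity (\sum_(j | (left_pt D j < p)%N) val (sigma j) -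
  \sum_(j | (right_pt D j < p)%N) val (sigma j)).
  elim: p => [|p IHp] /=; first by rewrite !big_pred0 // subr0.
  rewrite IHp /jump.
  have split (f : 'I_n -> 'I_(n.*2)) :
      \sum_(j | (f j < p.+1)%N) val (sigma j) =
      \sum_(j | (f j < p)%N) val (sigma j) +
      \sum_(j | f j == p :> nat) val (sigma j).
    rewrite (bigID [pred j | f j == p :> nat]) addrC /=; congr (_ + _).
      by apply: eq_bigl => j; case: eqP => [->|]; rewrite ?ltnSn ?andbF.
    by apply: eq_bigl => j; rewrite [in RHS]ltn_neqAle ltnS andbC.
  by rewrite !split opprD addrACA.
(* A chord closed before [p] was also opened before [p], so its two contributions cancel. *)
rewrite (bigID [pred j | right_pt D j < p]%N) /=.
under [X in X + _ - _]eq_bigl => j.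
  rewrite andb_idl; last by move/(ltn_trans (left_lt_right D j)).
  over.
by rewrite addrC addKr; apply: eq_bigl => j; rewrite -leqNgt.
Qed.

Lemma left_right_neq i j : left_pt D i != right_pt D j :> nat.
Proof.
apply/eqP => /val_inj e.
by have := bij_inj (end_point_bij D)
  (e : end_point D (inl i) = end_point D (inr j)).
Qed.

Lemma left_inj i j : left_pt D i = left_pt D j :> nat -> i = j.
Proof.
move=> /val_inj e.
by case: (bij_inj (end_point_bij D)
  (e : end_point D (inl i) = end_point D (inl j))).
Qed.

Lemma right_inj i j : right_pt D i = right_pt D j :> nat -> i = j.
Proof.
move=> /val_inj e.
by case: (bij_inj (end_point_bij D)
  (e : end_point D (inr i) = end_point D (inr j))).
Qed.

Lemma segval_left (sigma : {ffun 'I_n -> spin}) i :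
  segval D sigma (left_pt D i) =
  \sum_(j | open_at (left_pt D i) j) val (sigma j).
Proof.
rewrite segval_open; apply: eq_bigl => j; rewrite /open_at; congr (_ && _).
by rewrite [in RHS]ltn_neqAle left_right_neq.
Qed.

Lemma segval_right (sigma : {ffun 'I_n -> spin}) i :
  segval D sigma (right_pt D i) =
  val (sigma i) + \sum_(j | open_at (right_pt D i) j) val (sigma j).
Proof.
rewrite segval_open (bigD1 i) /= ?left_lt_right //=; congr (_ + _).
apply: eq_bigl => j; rewrite /open_at -andbA; congr (_ && _).
rewrite andbC ltn_neqAle.
by congr (~~ _ && _); rewrite eq_sym; apply/eqP/eqP => [->|/right_inj].
Qed.

Lemma left_ltE i j : (left_pt D i < left_pt D j)%N = (i < j)%N.
Proof.
have [ij|ji|/val_inj ->] := ltngtP i j; last by rewrite ltnn.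
- exact: left_pt_mono.
- by apply/negbTE; rewrite -leqNgt ltnW // left_pt_mono.
Qed.

(** As chords are numbered by left end-points, two that intersect have the left end of i under j
    when i > j (A_+) and its right end under j when i < j (A_-). Containment of i in j puts both
    ends under j, and A_c = A_+ + A_-. The proof runs through the orders of the four end-points. *)
Lemma IMJ_block_neq i j : i != j -> IMJ_block D i j =
  let l := (open_at (left_pt D i) j)%:R in
  let r := (open_at (right_pt D i) j)%:R in
  mx3 [:: [:: l; l; 0]; [:: - r; - r; 0]; [:: 0; 0; 0]].
Proof.
move=> neq_ij; rewrite /IMJ_block neq_ij (negbTE neq_ij) -left_ltE /=.
have li := left_lt_right D i; have lj := left_lt_right D j.
have neq_l : left_pt D i != left_pt D j :> nat.
  by apply: contra neq_ij => /eqP/left_inj ->.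
have neq_r : right_pt D i != right_pt D j :> nat.
  by apply: contra neq_ij => /eqP/right_inj ->.
rewrite /open_at /intersect /contained_in.
have lr := left_right_neq j i; have rl := left_right_neq i j.
move: neq_l neq_r li lj lr rl.
move: (left_pt D i : nat) (left_pt D j : nat).
move: (right_pt D i : nat) (right_pt D j : nat).
move=> r r' l l' neq_l neq_r lt_lr lt_lr' neq_l'r neq_lr'.
have [ll|ll|?] := ltngtP l l'; have [?|?|?] := ltngtP r r'; try lia;
have [?|?|?] := ltngtP l r'; have [?|?|?] := ltngtP l' r; try lia.
all: rewrite /= ?lt_lr ?oppr0 //=; apply/matrixP => a a'; rewrite !mxE.
all: by case: a a' => [[|[|[|a]]] pa] [[|[|[|a']]] pa'].
Qed.

Lemma IMJ_block_row (y : 'I_n -> 'I_3 -> {poly rat}) i a :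
  \sum_j \sum_a' IMJ_block D i j a a' * y j a' =
  nth 0 [:: (lambda + 2) * y i a0 +
           \sum_(j | open_at (left_pt D i) j) (y j a0 + y j a1);
         (lambda + 2) * y i a1 + y i a2 -
           \sum_(j | open_at (right_pt D i) j) (y j a0 + y j a1);
         lambda * y i a0 - (lambda + 2) * y i a1 + y i a2] a.
Proof.
have openl : open_at (left_pt D i) i = false by rewrite /open_at ltnn.
have openr : open_at (right_pt D i) i = false by rewrite /open_at ltnn andbF.
have drop_i (p : nat) (F : 'I_n -> {poly rat}) : open_at p i = false ->
    \sum_(j | open_at p j) F j = \sum_(j | j != i) (open_at p j)%:R * F j.
  move=> pi; rewrite big_mkcond (bigD1 i) //= pi add0r.
  by apply: eq_bigr => j _; case: ifP; rewrite ?mul1r ?mul0r.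
rewrite !drop_i // (bigD1 i) //= sum3.
under eq_bigr => j neq_ji do rewrite IMJ_block_neq 1?eq_sym // sum3 !mxE /=.
rewrite /IMJ_block eqxx /= !mxE.
case: a => [[|[|[|a]]] pa] //=.
- rewrite !mul0r !addr0; congr (_ + _).
  by apply: eq_bigr => j _; rewrite mul0r addr0 mulrDr.
- rewrite mul0r add0r mul1r -sumrN; congr (_ + _).
  by apply: eq_bigr => j _; rewrite mul0r addr0 mulrDr !mulNr opprD.
- rewrite mul1r big1 ?addr0 => [|j _]; last by rewrite !mul0r !addr0.
  by rewrite -opprD mulNr.
Qed.

Lemma chord_weightE (sigma : {ffun 'I_n -> spin}) i :
  chord_weight D sigma i =
  spin_weight (\sum_(j | open_at (left_pt D i) j) (val (sigma j))%:~R)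
    (\sum_(j | open_at (right_pt D i) j) (val (sigma j))%:~R) (val (sigma i)).
Proof.
by rewrite /chord_weight segval_left segval_right rmorphD !rmorph_sum.
Qed.

End Chords.

Theorem theorem1 (n : nat) (D : chord_diagram n) :
  WJ D = permanent (IMJ D).
Proof.
rewrite /IMJ (@permanent_glynn_block _ _ _ bool (fun _ b => (-1) ^+ (~~ b))
  node _ shift) => [|a|a]; first 1 last.
- by rewrite big_bool /=; ring.
- by rewrite big_bool /node /=; ring.
pose spins (g : {ffun 'I_n -> {ffun 'I_3 -> bool}}) :=
  [ffun i => spin_of (g i ord0) (g i (lift ord0 ord0))].
rewrite (partition_big spins predT) //=; apply: eq_bigr => sigma _.
rewrite (eq_bigr _ (fun i _ => etrans (chord_weightE D sigma i)
  (spin_weight_fiber _ _ _))).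
(* Choosing for each chord, independently, a triple with the prescribed spin is the same as choosing
   an assignment whose spin state is [sigma]. *)
rewrite bigA_distr_big_dep /=; apply: eq_big => [g|g /familyP gP].
  apply/familyP/eqP => [gP | <- i]; last by rewrite ffunE; apply: eqxx.
  by apply/ffunP => i; rewrite ffunE; apply/eqP/(gP i).
apply: eq_bigr => i _; congr (_ * _); apply: eq_bigr => a _; congr (_ + _).
rewrite IMJ_block_row.
have sumE p : \sum_(j | open_at D p j) (node ord0 (g j ord0) +
      node (lift ord0 ord0) (g j (lift ord0 ord0))) =
    \sum_(j | open_at D p j) (val (sigma j))%:~R :> {poly rat}.
  by apply: eq_bigr => j _; rewrite -spin_ofE (eqP (gP j)).
by rewrite !sumE.
Qed.
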